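(* Let $f:\mathbb{R}^n\to\mathbb{R}$ be convex and differentiable, let $h:\mathbb{R}^m\to\mathbb{R}$ be a closed convex function, let $A\in\mathbb{R}^{m\times n}$, $\nu>0$ and $\lambda^{(k)}\in\mathbb{R}^m$. Define $\phi_1:\mathbb{R}^n\to\mathbb{R}$ by $$\phi_1(x):=f(x)+\min_{y\in\mathbb{R}^m}\left\{h(y)+\langle \lambda^{(k)},Ax-y\rangle+\frac{\nu}{2}\|Ax-y\|^2\right\}.$$ If $\nabla f$ is Lipschitz continuous with parameter $L_f>0$, i.e. $\|\nabla f(x)-\nabla f(y)\|\le L_f\|x-y\|$ for all $x,y\in\mathbb{R}^n$, then for any $x_1,x_2\in\mathbb{R}^n$, $$\|\nabla\phi_1(x_1)-\nabla\phi_1(x_2)\|\le\left(L_f+\nu\lambda_{\max}(A^TA)\right)\|x_1-x_2\|.$$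
   Context: $\langle\cdot,\cdot\rangle$ and $\|\cdot\|$ denote the Euclidean inner product and norm. A convex function $h$ is closed if $\{y : h(y)\le\alpha\}$ is a closed set for each $\alpha\in\mathbb{R}$. $\lambda_{\max}(A^TA)$ denotes the largest eigenvalue of the symmetric matrix $A^TA$. The function $\phi_1$ is differentiable on $\mathbb{R}^n$ under these assumptions, so $\nabla\phi_1$ is well defined. The superscript in $\lambda^{(k)}$ is only an iteration index; $\lambda^{(k)}$ is a fixed vector, unrelated to $\lambda_{\max}$. *)

(* Defs.v *)
From HB Require Import structures.
From mathcomp Require Import all_boot all_order all_algebra.
From mathcomp Require Import all_classical all_reals all_analysis.
Set Implicit Arguments.
Unset Strict Implicit.
Unset Printing Implicit Defensive.
Import Order.TTheory GRing.Theory Num.Theory.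
Import numFieldNormedType.Exports.
Local Open Scope classical_set_scope.
Local Open Scope ring_scope.

Definition inner (R : realType) (n : nat) (u v : 'cV[R]_n) : R :=
  \sum_(i < n) u i 0 * v i 0.

(* The library norm `|u| on 'cV[R]_n is the sup norm, hence a separate
   Euclidean norm.  The two induce the same topology, so the library's
   [closed] and [differentiable] are unaffected. *)
Definition enorm (R : realType) (n : nat) (u : 'cV[R]_n) : R :=
  Num.sqrt (inner u u).

(* Attained extrema of a set of reals; the value is 0 (junk) when the extremum
   is not attained. *)
Definition minimum (R : realType) (S : set R) : R := xget 0 (S `&` lbound S).
Definition maximum (R : realType) (S : set R) : R := xget 0 (S `&` ubound S).

Definition lambda_max (R : realType) (n : nat) (M : 'M[R]_n) : R :=
  maximum [set a : R | eigenvalue M a].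

(* Vector of partial derivatives; meaningful when [f] is differentiable at [x]. *)
Definition grad (R : realType) (n : nat) (f : 'cV[R]_n -> R) (x : 'cV[R]_n) :
    'cV[R]_n :=
  \col_(i < n) 'D_(delta_mx i 0) f x.

(* Closedness in the sense of convex analysis: closed sublevel sets. *)
Definition closed_function (R : realType) (m : nat) (h : 'cV[R]_m -> R) : Prop :=
  forall alpha : R, closed [set y | h y <= alpha].

Definition penalized (R : realType) (m n : nat) (h : 'cV[R]_m -> R)
    (A : 'M[R]_(m, n)) (nu : R) (lam : 'cV[R]_m) (x : 'cV[R]_n)
    (y : 'cV[R]_m) : R :=
  h y + inner lam (A *m x - y) + nu / 2 * enorm (A *m x - y) ^+ 2.

Definition phi1 (R : realType) (m n : nat) (f : 'cV[R]_n -> R)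
    (h : 'cV[R]_m -> R) (A : 'M[R]_(m, n)) (nu : R) (lam : 'cV[R]_m)
    (x : 'cV[R]_n) : R :=
  f x + minimum (range (penalized h A nu lam x)).

(* Main.v *)
Require Import Defs.
From HB Require Import structures.
From mathcomp Require Import all_boot all_order all_algebra.
From mathcomp Require Import all_classical all_reals all_analysis.
From mathcomp Require Import ring lra.
Import Order.TTheory GRing.Theory Num.Theory.
Import numFieldNormedType.Exports.
Local Open Scope classical_set_scope.
Local Open Scope ring_scope.

(* Let e w be the minimum over y of h y + <lam, w - y> + nu/2 |w - y|^2, attained
   at p w, so that phi1 = f + e o A.  Testing the minimality of p w against convex
   combinations gives the subgradient inequality for lam + nu (w - p w), hence the
   residual q w = w - p w is firmly nonexpansive.  Comparing the values at w and w'
   through the two minimizers then gives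
   |e w' - e w - <lam + nu q w, w' - w>| <= nu/2 |w' - w|^2, so e is differentiable
   with gradient lam + nu q, and the gradient of e o A at x is
   A^T (lam + nu q (A x)).  The Lipschitz constant follows since both A and A^T
   have Euclidean operator norm at most sqrt (lambda_max (A^T A)). *)

(** * Euclidean inner product and norm *)

Lemma innerE {R : realType} {n : nat} (u v : 'cV[R]_n) :
  inner u v = (u^T *m v) 0 0.
Proof. by rewrite mxE; apply: eq_bigr => i _; rewrite mxE. Qed.

Lemma innerC {R : realType} {n : nat} (u v : 'cV[R]_n) :
  inner u v = inner v u.
Proof. by apply: eq_bigr => i _; rewrite mulrC. Qed.

Lemma innerDr {R : realType} {n : nat} (u v w : 'cV[R]_n) :
  inner u (v + w) = inner u v + inner u w.
Proof. by rewrite !innerE mulmxDr mxE. Qed.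

Lemma innerZr {R : realType} {n : nat} (a : R) (u v : 'cV[R]_n) :
  inner u (a *: v) = a * inner u v.
Proof. by rewrite !innerE -scalemxAr mxE. Qed.

Lemma inner0r {R : realType} {n : nat} (u : 'cV[R]_n) : inner u 0 = 0.
Proof. by rewrite innerE mulmx0 mxE. Qed.

Lemma innerNr {R : realType} {n : nat} (u v : 'cV[R]_n) :
  inner u (- v) = - inner u v.
Proof. by rewrite -scaleN1r innerZr mulN1r. Qed.

Lemma innerDl {R : realType} {n : nat} (u v w : 'cV[R]_n) :
  inner (v + w) u = inner v u + inner w u.
Proof. by rewrite innerC innerDr !(innerC u). Qed.

Lemma innerZl {R : realType} {n : nat} (a : R) (u v : 'cV[R]_n) :
  inner (a *: v) u = a * inner v u.
Proof. by rewrite innerC innerZr innerC. Qed.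

Lemma innerNl {R : realType} {n : nat} (u v : 'cV[R]_n) :
  inner (- v) u = - inner v u.
Proof. by rewrite innerC innerNr innerC. Qed.

Definition inner_lin := (@innerDl, @innerDr, @innerNl, @innerNr, @innerZl,
  @innerZr).

Lemma inner_mulmx {R : realType} {m n : nat} (A : 'M[R]_(m, n)) u v :
  inner (A *m u) v = inner u (A^T *m v).
Proof. by rewrite !innerE trmx_mul mulmxA. Qed.

Lemma inner_ge0 {R : realType} {n : nat} (u : 'cV[R]_n) : 0 <= inner u u.
Proof. by apply: sumr_ge0 => i _; rewrite -expr2 sqr_ge0. Qed.

Lemma inner_eq0 {R : realType} {n : nat} (u : 'cV[R]_n) :
  inner u u = 0 -> u = 0.
Proof.
move=> /eqP; rewrite psumr_eq0 => [/allP u0|i _]; last by rewrite -expr2 sqr_ge0.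
apply/matrixP => i j; rewrite (ord1 j) mxE.
by have := u0 i (mem_index_enum i); rewrite mulf_eq0 orbb => /eqP.
Qed.

Lemma enorm_ge0 {R : realType} {n : nat} (u : 'cV[R]_n) : 0 <= enorm u.
Proof. exact: sqrtr_ge0. Qed.

Lemma sqr_enorm {R : realType} {n : nat} (u : 'cV[R]_n) :
  enorm u ^+ 2 = inner u u.
Proof. by rewrite sqr_sqrtr // inner_ge0. Qed.

Lemma enormZ {R : realType} {n : nat} (a : R) (u : 'cV[R]_n) :
  0 <= a -> enorm (a *: u) = a * enorm u.
Proof.
by move=> a0; rewrite /enorm !inner_lin mulrA -expr2 sqrtrM ?sqr_ge0 //
  sqrtr_sqr ger0_norm.
Qed.

(** Cauchy-Schwarz, from the nonnegative squared norm of |v|^2 u - <u, v> v, which equals |v|^2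
    (|u|^2 |v|^2 - <u, v>^2). *)
Lemma inner_le_enorm {R : realType} {n : nat} (u v : 'cV[R]_n) :
  inner u v <= enorm u * enorm v.
Proof.
have [v0|v0] := eqVneq (inner v v) 0.
  by rewrite (inner_eq0 _ v0) inner0r mulr_ge0 // enorm_ge0.
have vgt0 : 0 < inner v v by rewrite lt0r v0 inner_ge0.
rewrite -[leRHS]ger0_norm ?mulr_ge0 ?enorm_ge0 // -sqrtr_sqr.
apply: le_trans (ler_norm _) _; rewrite -sqrtr_sqr ler_wsqrtr //.
rewrite exprMn !sqr_enorm.
have := inner_ge0 (inner v v *: u - inner u v *: v).
rewrite !inner_lin (innerC v u).
move: (inner u u) (inner u v) (inner v v) vgt0 => a b c c0.
rewrite [X in 0 <= X](_ : _ = c * (a * c - b ^+ 2)); last ring.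
by rewrite pmulr_rge0 // subr_ge0.
Qed.

Lemma enormD {R : realType} {n : nat} (u v : 'cV[R]_n) :
  enorm (u + v) <= enorm u + enorm v.
Proof.
rewrite -(ler_pXn2r (n := 2)) ?nnegrE ?addr_ge0 ?enorm_ge0 //.
rewrite sqrrD !sqr_enorm !inner_lin (innerC v u).
have := inner_le_enorm u v; lra.
Qed.

Lemma coord_le_enorm {R : realType} {n : nat} (u : 'cV[R]_n) i :
  `|u i 0| <= enorm u.
Proof.
rewrite -sqrtr_sqr ler_wsqrtr // /inner (bigD1 i) //= -expr2 lerDl.
by apply: sumr_ge0 => j _; rewrite -expr2 sqr_ge0.
Qed.

Lemma inner_le_norm {R : realType} {n : nat} (u : 'cV[R]_n) :
  inner u u <= n%:R * `|u| ^+ 2.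
Proof.
rewrite -[n in n%:R]card_ord -sum1_card natr_sum mulr_suml.
apply: ler_sum => i _; rewrite mul1r -expr2 -real_normK ?num_real //.
rewrite ler_pXn2r ?nnegrE // /Num.norm/= mx_normrE.
exact: (le_bigmax _ (fun ij => `|u ij.1 ij.2|) (i, 0)).
Qed.

(** * Compactness and attained extrema *)

Lemma compact_box {R : realType} {n : nat} (w : 'cV[R]_n) (r : R) :
  compact [set y : 'cV[R]_n | forall i, `|y i 0 - w i 0| <= r].
Proof.
have -> : [set y : 'cV[R]_n | forall i, `|y i 0 - w i 0| <= r] =
    trmx @` [set v : 'rV[R]_n | forall i, `[w i 0 - r, w i 0 + r]%classic (v ord0 i)].
  apply/seteqP; split => [y /= yr|_ [v /= vr <-]] /=.
    exists y^T; last by rewrite trmxK.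
    by move=> i; rewrite /= in_itv/= mxE -ler_distl.
  by move=> i; have := vr i; rewrite /= in_itv/= mxE -ler_distl.
apply: continuous_compact; last first.
  apply: (@rV_compact _ _ (fun i => `[w i 0 - r, w i 0 + r]%classic)) => i.
  exact: segment_compact.
apply: continuous_subspaceT => v B /nbhs_ballP[e e0 eB].
apply/nbhs_ballP; exists e => // u [_ uv]; apply: eB; split => // i j.
by rewrite !mxE; exact: uv.
Qed.

(** Without a minimizer the open sets {F y < F x}, y in [K], cover [K]. In a finite subcover, the
    index with least F value lies in none of the chosen sets. *)
Lemma lsc_compact_min {R : realType} {T : ptopologicalType} (K : set T)
    (F : T -> R) :
  K !=set0 -> compact K -> (forall y, open [set x | F y < F x]) ->
  exists2 c, K c & forall t, K t -> F c <= F t.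
Proof.
move=> [k0 Kk0] cK oF; apply: contrapT => nomin.
have nm x : K x -> exists2 y, K y & F y < F x.
  move=> Kx; apply: contrapT => xmin; apply: nomin; exists x => // t Kt.
  by rewrite leNgt; apply/negP => tx; apply: xmin; exists t.
move: cK; rewrite compact_cover => /(_ T K (fun y => [set x | F y < F x])).
case=> [//|x Kx|D DK KD]; first by have [y Ky yx] := nm x Kx; exists y.
have smin (s : seq T) x : x \in s ->
    exists2 a, a \in s & forall b, b \in s -> F a <= F b.
  move: x; elim: s => // a [|b s] IH x _.
    by exists a => [|c]; rewrite inE // => /eqP ->.
  have [|c cs cmin] := IH b; first by rewrite mem_head.
  have [ca|/ltW ac] := leP (F c) (F a).
    by exists c => [|d]; rewrite inE ?cs ?orbT // => /predU1P[->|/cmin].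
  exists a => [|d]; rewrite inE ?eqxx // => /predU1P[->//|/cmin].
  exact: le_trans.
have [d Dd _] := KD _ Kk0.
have [a Da amin] := smin (finmap.enum_fset D) d Dd.
have Ka : K a by have := DK a Da; rewrite inE.
have [b Db /=] := KD a Ka.
by rewrite ltNge amin.
Qed.

(** Replaces the limit t -> 0 in first-order arguments: if a < 0, the value at t = -a / (b - a) is
    -a^2 / (b - a) < 0. *)
Lemma ge0_of_small {R : realType} (a b : R) :
  (forall t, 0 < t -> t <= 1 -> 0 <= a + t * b) -> 0 <= a.
Proof.
move=> H; rewrite leNgt; apply/negP => a0.
have b0 : 0 < b by have := H 1 ltr01 (lexx 1); lra.
have c0 : 0 < b - a by lra.
have := H (- a / (b - a)).
rewrite divr_gt0 ?oppr_gt0 // ler_pdivrMr // => /(_ isT) H1.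
have {H1}: 0 <= a + - a / (b - a) * b by apply: H1; lra.
rewrite [X in 0 <= X](_ : _ = - (a ^+ 2 / (b - a))); last first.
  by field; rewrite gt_eqF.
by rewrite oppr_ge0 leNgt divr_gt0 // exprn_even_gt0 //= lt_eqF.
Qed.

Lemma minimumE {R : realType} (S : set R) a :
  S a -> lbound S a -> minimum S = a.
Proof.
move=> Sa aS; rewrite /minimum; case: xgetP => [_ -> [Sb bS]|/(_ a)[]//].
by apply/eqP; rewrite eq_le bS // aS.
Qed.

Lemma maximumE {R : realType} (S : set R) a :
  S a -> ubound S a -> maximum S = a.
Proof.
move=> Sa aS; rewrite /maximum; case: xgetP => [_ -> [Sb bS]|/(_ a)[]//].
by apply/eqP; rewrite eq_le bS // aS.
Qed.

(** * The largest eigenvalue of A^T A *)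

Lemma continuous_inner {R : realType} {T : topologicalType} {n : nat}
    (u v : T -> 'cV[R]_n) :
  (forall i, continuous (fun t => u t i 0)) ->
  (forall i, continuous (fun t => v t i 0)) ->
  continuous (fun t => inner (u t) (v t)).
Proof.
move=> cu cv; apply: (@continuous_big R) => [z|i _ t]; first exact: add_continuous.
by apply: cvgM; [exact: cu | exact: cv].
Qed.

Lemma continuous_coord {R : realType} {n : nat} i :
  continuous (fun u : 'cV[R]_n => u i 0).
Proof. exact: coord_continuous. Qed.

Lemma continuous_mulmx_coord {R : realType} {m n : nat} (A : 'M[R]_(m, n)) i :
  continuous (fun u : 'cV[R]_n => (A *m u) i 0).
Proof.
rewrite [X in continuous X](_ : _ = fun u => inner (row i A)^T u).
  by apply: continuous_inner => j;
    [exact: cst_continuous|exact: continuous_coord].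
by apply/funext => u; rewrite mxE; apply: eq_bigr => j _; rewrite !mxE.
Qed.

(* A maximizer x of |A u|^2 over the unit sphere is an eigenvector of A^T A: with
   mu the maximum, mu |u|^2 - |A u|^2 is nonnegative and vanishes at x, so its
   derivative at x vanishes.  For n = 0 there are no eigenvalues and lambda_max
   is its junk value 0. *)
Lemma lambda_maxP {R : realType} {m n : nat} (A : 'M[R]_(m, n)) :
  0 <= lambda_max (A^T *m A) /\
  forall x, inner (A *m x) (A *m x) <= lambda_max (A^T *m A) * inner x x.
Proof.
case: n A => [|n] A.
  split; last by move=> x; rewrite (flatmx0 x) mulmx0 !inner0r mulr0.
  rewrite /lambda_max /maximum; case: xgetP => // a _ [+ _]; rewrite /= /eigenvalue.
  by rewrite (flatmx0 (eigenspace _ _)) eqxx.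
set q := fun u : 'cV[R]_n.+1 => inner (A *m u) (A *m u).
have cq : continuous q.
  apply: continuous_inner => i; exact: continuous_mulmx_coord.
have cn : continuous (fun u : 'cV[R]_n.+1 => inner u u).
  by apply: continuous_inner => i; exact: continuous_coord.
have [|||x] := compact_EVT_max
    (A := [set u : 'cV[R]_n.+1 | inner u u = 1]) (f := q).
- exists (delta_mx 0 0); rewrite /= /inner (bigD1 0) //= big1 ?addr0.
    by rewrite mxE eqxx mulr1.
  by move=> i /negPf i0; rewrite mxE i0 mul0r.
- apply: subclosed_compact (compact_box 0 1) _.
    exact: (preimage_closed (fun u _ => cn u) (@closed_eq R 1)).
  move=> u /= u1 i; rewrite mxE subr0 (le_trans (coord_le_enorm _ _)) //.
  by rewrite /enorm u1 sqrtr1.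
- exact: continuous_subspaceT.
rewrite inE /= => x1 xmax.
have qle y : q y <= q x * inner y y.
  have [y0|y0] := eqVneq (inner y y) 0.
    by rewrite (inner_eq0 _ y0) /q mulmx0 !inner0r mulr0.
  have n0 : enorm y != 0 by rewrite -sqrf_eq0 sqr_enorm.
  have /= := xmax ((enorm y)^-1 *: y).
  rewrite inE /= /q -scalemxAr !inner_lin -(sqr_enorm y) mulrA -expr2 exprVn.
  rewrite mulVf ?expf_neq0 // => /(_ erefl).
  by rewrite mulrA -expr2 exprVn ler_pdivrMl ?exprn_gt0 ?lt0r ?n0 ?enorm_ge0 //
    mulrC.
have eig : A^T *m A *m x = q x *: x.
  apply/eqP; rewrite eq_sym -subr_eq0; apply/eqP.
  move zE: (_ - _) => z; apply: inner_eq0; apply/eqP.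
  rewrite eq_le inner_ge0 andbT.
  rewrite -(pmulr_rle0 _ (ltr0n R 2)) -oppr_ge0.
  apply: (@ge0_of_small R _ (q x * inner z z - q z)) => t t0 _.
  have := qle (x - t *: z).
  rewrite /q mulmxBr -scalemxAr !inner_lin x1 (innerC z x) (innerC (A *m z)).
  have zz : inner z z = q x * inner x z - inner (A *m x) (A *m z).
    by rewrite -{1}zE !inner_lin -mulmxA (innerC (A^T *m _)) -inner_mulmx
      (innerC (A *m z)).
  rewrite -/(q x) -/(q z) -(pmulr_rge0 _ t0) zz.
  move: (inner x z) (inner _ _) (inner z z) (q z) (q x) => *; lra.
have mulE : lambda_max (A^T *m A) = q x.
  apply: maximumE.
    (* [eigenvalue] refers to row eigenvectors, so [eig] is transposed, using the symmetry of A^T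
       A. *)
    apply/eigenvalueP; exists x^T.
      by rewrite -linearZ -eig /= !trmx_mul trmxK.
    apply/eqP => /(congr1 trmx); rewrite trmxK trmx0 => x0.
    by have /eqP := x1; rewrite x0 inner0r eq_sym oner_eq0.
  move=> a /eigenvalueP[v va v0]; set y := v^T.
  have y0 : 0 < inner y y.
    rewrite lt0r inner_ge0 andbT; apply: contra v0 => /eqP/inner_eq0 y0.
    by rewrite -[v]trmxK -/y y0 trmx0.
  rewrite -(ler_pM2r y0); apply: le_trans (qle y).
  have -> : q y = inner y (A^T *m A *m y) by rewrite /q inner_mulmx mulmxA.
  rewrite -innerZr /y -linearZ -va /= trmx_mul trmx_mul trmxK //.
by rewrite mulE; split => //; exact: inner_ge0.
Qed.

(** * Existence of the inner minimizer *)

Lemma convex_functionE {R : realType} {n : nat} (h : 'cV[R]_n -> R) :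
  convex_function [set: 'cV[R]_n] h ->
  forall x y t, 0 <= t -> t <= 1 ->
    h (t *: x + (1 - t) *: y) <= t * h x + (1 - t) * h y.
Proof.
by move=> hc x y t t0 t1; have := hc (Itv01 t0 t1) x y (in_setT _) (in_setT _).
Qed.

Lemma open_gt_add {R : realType} {T : topologicalType} (h c : T -> R) (a : R) :
  (forall b, closed [set y | h y <= b]) -> continuous c ->
  open [set y | a < h y + c y].
Proof.
move=> hcl cc; rewrite openE => y /= ay; rewrite /interior.
set e := (h y + c y - a) / 2.
have e0 : 0 < e by rewrite divr_gt0 // subr_gt0.
have oh : open [set z | h y - e < h z].
  rewrite (_ : mkset _ = ~` [set z | h z <= h y - e]); first exact: closed_openC.
  by apply/seteqP; split => z /=; rewrite ltNge => /negP.
have nh : \forall z \near y, h y - e < h z.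
  by apply: open_nbhs_nbhs; split => //=; rewrite ltrBlDr ltrDl.
have nc : \forall z \near y, c y - e < c z.
  by apply: (cvgr_gt _ (cc y)); rewrite ltrBlDr ltrDl.
near=> z.
have : h y - e < h z by near: z.
have : c y - e < c z by near: z.
rewrite /e /=; lra.
Unshelve. all: by end_near. Qed.

Lemma continuous_affine {R : realType} {T : topologicalType} (f : T -> R) a b :
  continuous f -> continuous (fun t => a + b * f t).
Proof.
move=> cf t; apply: cvgD; first exact: cvg_cst.
by apply: cvgM; [exact: cvg_cst|exact: cf].
Qed.

(** [penalized] with a free point w in place of A x. Completing the square shows that its minimum
    over y is the Moreau envelope of h at w + lam / nu, up to a constant. *)
Definition moreau {R : realType} {m : nat} (h : 'cV[R]_m -> R) (nu : R)
    (lam w y : 'cV[R]_m) : R :=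
  h y + inner lam (w - y) + nu / 2 * enorm (w - y) ^+ 2.

(* By lower semicontinuity h is bounded below on a box around w; convexity along
   rays from w extends this to an affine lower bound in |y - w| outside the box,
   which the quadratic term beats. *)
Lemma moreau_min {R : realType} {m : nat} (h : 'cV[R]_m -> R) (nu : R) lam w :
  convex_function [set: 'cV[R]_m] h -> closed_function h -> 0 < nu ->
  exists y, forall z, moreau h nu lam w y <= moreau h nu lam w z.
Proof.
move=> hconv hclosed nu0.
have [|y|c cbox cmin] := @lsc_compact_min R _ _ h _ (compact_box w 1).
- by exists w => i; rewrite subrr normr0.
- by have := @open_gt_add R _ h (fun=> 0) (h y) hclosed (@cst_continuous _ _ 0);
    under eq_set do rewrite addr0.
(* With s = |w - y| >= 1, the objective at y is at least h w - C s + nu/2 s^2, which is at least h w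
   once s >= 2 C / nu; this dictates [r]. *)
set C := h w - h c + enorm lam.
have C0 : 0 <= C.
  rewrite addr_ge0 ?enorm_ge0 // subr_ge0 cmin // => i.
  by rewrite subrr normr0.
set r := Num.max 1 (2 * C / nu).
have [r1 rC] : 1 <= r /\ 2 * C / nu <= r by rewrite !le_max !lexx orbT.
have far y : r <= enorm (w - y) -> moreau h nu lam w w <= moreau h nu lam w y.
  move=> rs; set s := enorm (w - y) in rs.
  have s0 : 0 < s by lra.
  have sV0 : 0 <= s^-1 by rewrite invr_ge0 ltW.
  have sV1 : s^-1 <= 1 by rewrite invf_le1 //; lra.
  (* The combination is the point of the segment from w to y at distance 1 from w; it lies in the
     unit box, where h >= h c. *)
  have := convex_functionE _ hconv y w _ sV0 sV1.
  set v := (_ + _) => hv.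
  have vE : w - v = s^-1 *: (w - y).
    by apply/matrixP => i j; rewrite !mxE; ring.
  have : h c <= h v.
    apply: cmin => i; rewrite distrC.
    have := coord_le_enorm (w - v) i.
    rewrite {2}vE enormZ // -/s mulVf ?gt_eqF //.
    by rewrite !mxE.
  move=> /le_trans /(_ hv); rewrite -(ler_pM2l s0) mulrDr !mulrA mulrBr mulr1.
  rewrite mulfV ?gt_eqF // mul1r => hy.
  have := inner_le_enorm (- lam) (w - y).
  rewrite innerNl {1}/enorm innerNl innerNr opprK -/(enorm lam) -/s => ly.
  rewrite /moreau subrr inner0r -/s sqr_enorm inner0r mulr0 !addr0.
  have : C <= s * nu / 2.
    by have := le_trans rC rs; rewrite ler_pdivrMr //; lra.
  rewrite -(ler_pM2l s0) /C => Cs; nra.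
have [|y|y0 _ y0min] :=
    @lsc_compact_min R _ _ (moreau h nu lam w) _ (compact_box w r).
- by exists w => i; rewrite subrr normr0; lra.
- under eq_set do rewrite [X in _ < X]/moreau -addrA.
  apply: (open_gt_add h) => //.
  under eq_fun do rewrite sqr_enorm -innerZl -innerDl.
  apply: continuous_inner => i.
    under eq_fun do rewrite !mxE mulrBr -mulNr addrA.
    exact: continuous_affine (continuous_coord i).
  under eq_fun do rewrite !mxE -mulN1r.
  exact: continuous_affine (continuous_coord i).
exists y0 => z.
have [zr|] := pselect (forall i, `|z i 0 - w i 0| <= r); first exact: y0min.
move=> /existsNP[i /negP]; rewrite -ltNge distrC => zr.
apply: (@le_trans _ _ (moreau h nu lam w w)).
  by apply: y0min => j; rewrite subrr normr0; lra.
apply: far; apply: ltW; apply: lt_le_trans zr _.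
by have := coord_le_enorm (w - z) i; rewrite !mxE.
Qed.

(** * Variational inequalities at the minimizer *)

Lemma moreau_argmin_subgradient {R : realType} {m : nat} (h : 'cV[R]_m -> R)
    (nu : R) lam w p :
  convex_function [set: 'cV[R]_m] h ->
  (forall z, moreau h nu lam w p <= moreau h nu lam w z) ->
  forall z, inner (lam + nu *: (w - p)) (z - p) <= h z - h p.
Proof.
move=> hconv pmin z; rewrite -subr_ge0.
(* The quadratic term of the objective at t z + (1 - t) p leaves this remainder after division by
   t. *)
apply: (@ge0_of_small R _ (nu / 2 * inner (z - p) (z - p))) => t t0 t1.
have := pmin (t *: z + (1 - t) *: p).
have := convex_functionE _ hconv z p t (ltW t0) t1.
rewrite /moreau !sqr_enorm.
have -> : w - (t *: z + (1 - t) *: p) = (w - p) - t *: (z - p).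
  by apply/matrixP => i j; rewrite !mxE; ring.
move: (w - p) (z - p) (h (_ + _)) => q d hv.
rewrite !inner_lin (innerC d q) -(pmulr_rge0 _ t0).
move: (inner _ _) (inner _ _) (inner _ _) (inner _ _) (inner _ _) => *; nra.
Qed.

(** Adding the two subgradient inequalities cancels h and lam and leaves nu <dq, dq - (w1 - w2)> <=
    0. *)
Lemma moreau_residual_firm {R : realType} {m : nat} (h : 'cV[R]_m -> R)
    (nu : R) lam w1 p1 w2 p2 :
  convex_function [set: 'cV[R]_m] h -> 0 < nu ->
  (forall z, moreau h nu lam w1 p1 <= moreau h nu lam w1 z) ->
  (forall z, moreau h nu lam w2 p2 <= moreau h nu lam w2 z) ->
  let dq := (w1 - p1) - (w2 - p2) in inner dq dq <= inner dq (w1 - w2).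
Proof.
move=> hconv nu0 min1 min2.
have := moreau_argmin_subgradient _ _ _ _ _ hconv min1 p2.
have := moreau_argmin_subgradient _ _ _ _ _ hconv min2 p1.
have -> : p1 - p2 = (w1 - w2) - ((w1 - p1) - (w2 - p2)).
  by apply/matrixP => i j; rewrite !mxE; ring.
have -> : p2 - p1 = ((w1 - p1) - (w2 - p2)) - (w1 - w2).
  by apply/matrixP => i j; rewrite !mxE; ring.
move: (w1 - p1) (w2 - p2) (w1 - w2) => q1 q2 d /=.
rewrite !inner_lin (innerC q2 q1) -subr_ge0 -[in X in _ -> X]subr_ge0.
move=> H1 H2; rewrite -subr_ge0 -(pmulr_rge0 _ nu0); lra.
Qed.

(** Testing p at w' gives the upper bound. Testing p' at w gives the lower bound up to nu <q' - q,
    w' - w>, where q = w - p and q' = w' - p'; this term is nonnegative by firm nonexpansiveness. *)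
Lemma moreau_quadratic_bound {R : realType} {m : nat} (h : 'cV[R]_m -> R)
    (nu : R) lam w p w' p' :
  convex_function [set: 'cV[R]_m] h -> 0 < nu ->
  (forall z, moreau h nu lam w p <= moreau h nu lam w z) ->
  (forall z, moreau h nu lam w' p' <= moreau h nu lam w' z) ->
  `|moreau h nu lam w' p' - moreau h nu lam w p
     - inner (lam + nu *: (w - p)) (w' - w)| <=
  nu / 2 * inner (w' - w) (w' - w).
Proof.
move=> hconv nu0 min1 min2.
have /= := moreau_residual_firm _ _ _ _ _ _ _ hconv nu0 min2 min1.
have := inner_ge0 ((w' - p') - (w - p)).
have := min1 p'; have := min2 p.
rewrite /moreau !sqr_enorm.
have -> : w' - p = (w - p) + (w' - w) by apply/matrixP => i j; rewrite !mxE; ring.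
have -> : w - p' = (w' - p') - (w' - w).
  by apply/matrixP => i j; rewrite !mxE; ring.
move: (w - p) (w' - p') (w' - w) => q q' d H1 H2 H3 H4.
have : 0 <= nu * inner (q' - q) d.
  by rewrite mulr_ge0 ?(ltW nu0) // (le_trans H3).
move: H1 H2 {H3 H4}; rewrite !inner_lin (innerC d q) (innerC d q').
by move=> *; rewrite ler_norml; lra.
Qed.

(** * Differentials and gradients *)

HB.instance Definition _ (R : realType) (n : nat) (u : 'cV[R]_n) :=
  GRing.isLinear.Build R 'cV[R]_n R *%R (inner u)
    (fun a v w => etrans (innerDr u (a *: v) w)
                         (congr1 (+%R^~ _) (innerZr a u v))).

Lemma is_diff_of_quadratic_bound {R : realType} {n : nat}
    (F : 'cV[R]_n -> R) (x g : 'cV[R]_n) (C : R) :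
  (forall d, `|F (d + x) - F x - inner g d| <= C * `|d| ^+ 2) ->
  is_diff x F (inner g).
Proof.
move=> FC.
have cg : continuous (inner g).
  apply: continuous_inner => i; [exact: cst_continuous|exact: continuous_coord].
have Fo : (F : _ -> R^o) \o shift x = cst (F x : R^o) + (inner g : _ -> R^o)
    +o_ (0 : 'cV[R]_n) id.
  apply/eqaddoP => e e0; near=> d; rewrite /= !fctE /=.
  rewrite opprD addrA; apply: le_trans (FC d) _.
  rewrite expr2 mulrA ler_wpM2r //.
  (* [C] may be zero or negative; |C| + 1 can be divided by. *)
  apply: (@le_trans _ _ ((`|C| + 1) * `|d|)).
    by rewrite ler_wpM2r // ler_wpDr // ler_norm.
  have C1 : 0 < `|C| + 1 by rewrite ltr_wpDl.
  rewrite -ler_pdivlMl //; near: d; apply: (@nbhs0_le R 'cV[R]_n).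
  by rewrite mulr_gt0 ?invr_gt0.
have dE : 'd F x = inner g :> (_ -> _) by exact: diff_unique.
by apply: DiffDef => //; apply/diff_locallyP; rewrite dE.
Unshelve. all: by end_near. Qed.

Lemma grad_diff {R : realType} {n : nat} (F : 'cV[R]_n -> R) x g :
  is_diff x F (inner g) -> grad F x = g.
Proof.
move=> Fg; apply/matrixP => i j; rewrite (ord1 j) mxE deriveE //.
rewrite diff_val /inner (bigD1 i) //= mxE !eqxx mulr1 big1 ?addr0 //.
by move=> k /negPf ki; rewrite mxE ki mulr0.
Qed.

Lemma gradD {R : realType} {n : nat} (F G : 'cV[R]_n -> R) x :
  differentiable F x -> differentiable G x ->
  grad (F + G) x = grad F x + grad G x.
Proof.
move=> dF dG; apply/matrixP => i j; rewrite !mxE !deriveE ?diffD //.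
exact: differentiableD.
Qed.

(** * Operator norm bounds and the Lipschitz estimate *)

Lemma le_of_sqr_le_mul {R : realType} (a b : R) :
  0 <= b -> a ^+ 2 <= a * b -> a <= b.
Proof. by move=> b0 ab; rewrite leNgt; apply/negP => ba; nra. Qed.

Lemma enorm_mulmx {R : realType} {m n : nat} (A : 'M[R]_(m, n)) x :
  enorm (A *m x) <= Num.sqrt (lambda_max (A^T *m A)) * enorm x.
Proof.
have [L0 LA] := lambda_maxP A.
by rewrite -sqrtrM // ler_wsqrtr.
Qed.

(** From |A^T v|^2 = <A A^T v, v> <= |A (A^T v)| |v|, the bound for A applies at A^T v, and one
    factor |A^T v| cancels. *)
Lemma enorm_trmx_mulmx {R : realType} {m n : nat} (A : 'M[R]_(m, n)) v :
  enorm (A^T *m v) <= Num.sqrt (lambda_max (A^T *m A)) * enorm v.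
Proof.
apply: le_of_sqr_le_mul; first by rewrite mulr_ge0 ?enorm_ge0 ?sqrtr_ge0.
rewrite sqr_enorm -inner_mulmx; apply: le_trans (inner_le_enorm _ _) _.
by rewrite mulrA ler_wpM2r ?enorm_ge0 // mulrC enorm_mulmx.
Qed.

(* The first two conjuncts say that the objects in the third one are well
   defined: the minimum defining phi1 is attained, and phi1 has a gradient. *)
Theorem theorem2 (R : realType) (m n : nat)
    (f : 'cV[R]_n -> R) (h : 'cV[R]_m -> R)
    (A : 'M[R]_(m, n)) (nu : R) (lam : 'cV[R]_m) (Lf : R)
    (f_convex : convex_function [set: 'cV[R]_n] f)
    (f_diff : forall x : 'cV[R]_n, differentiable f x)
    (h_convex : convex_function [set: 'cV[R]_m] h)
    (h_closed : closed_function h)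
    (nu_gt0 : 0 < nu)
    (Lf_gt0 : 0 < Lf)
    (gradf_lipschitz : forall x y : 'cV[R]_n,
        enorm (grad f x - grad f y) <= Lf * enorm (x - y)) :
  [/\ forall x : 'cV[R]_n, exists y : 'cV[R]_m, forall z : 'cV[R]_m,
        penalized h A nu lam x y <= penalized h A nu lam x z,
      forall x : 'cV[R]_n, differentiable (phi1 f h A nu lam) x
    & forall x1 x2 : 'cV[R]_n,
        enorm (grad (phi1 f h A nu lam) x1 - grad (phi1 f h A nu lam) x2)
        <= (Lf + nu * lambda_max (A^T *m A)) * enorm (x1 - x2)].
Proof.
have [p pmin] := choice (fun w => moreau_min h nu lam w h_convex h_closed nu_gt0).
pose e (x : 'cV[R]_n) := moreau h nu lam (A *m x) (p (A *m x)).
pose G x := A^T *m (lam + nu *: (A *m x - p (A *m x))).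
have [L0 LA] := lambda_maxP A.
set L := lambda_max _ in L0 LA *.
have phiE : phi1 f h A nu lam = f + e.
  apply/funext => x; rewrite /phi1; congr (_ + _); apply: minimumE.
    by exists (p (A *m x)).
  by move=> _ [z _ <-]; exact: pmin.
have eG x : is_diff x e (inner (G x)).
  (* [L] bounds |A d|^2 by the Euclidean |d|^2, and n passes from there to the sup norm. *)
  apply: (@is_diff_of_quadratic_bound _ _ _ _ _ (nu / 2 * (L * n%:R))) => d.
  rewrite -[G x]/(A^T *m _) innerC -inner_mulmx innerC.
  have := moreau_quadratic_bound _ _ _ _ _ _ _ h_convex nu_gt0
    (pmin (A *m x)) (pmin (A *m (d + x))).
  rewrite -mulmxBr addrK => /le_trans; apply.
  rewrite -[leRHS]mulrA ler_pM2l ?divr_gt0 //; apply: le_trans (LA d) _.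
  by rewrite -mulrA ler_wpM2l // inner_le_norm.
have gE x : grad e x = G x by exact: grad_diff.
have de x : differentiable e x by have [] := eG x.
split.
- by move=> x; exists (p (A *m x)) => z; exact: pmin.
- by move=> x; rewrite phiE; exact: differentiableD.
move=> x1 x2; rewrite phiE !(gradD f e) // !gE.
rewrite opprD addrACA; apply: le_trans (enormD _ _) _.
(* The f part is the Lipschitz hypothesis; in the other part lam cancels, leaving nu A^T [dq]. *)
rewrite mulrDl lerD // /G -mulmxBr opprD addrACA subrr add0r -scalerBr -scalemxAr.
rewrite enormZ ?(ltW nu_gt0) // -mulrA ler_pM2l //.
have := moreau_residual_firm _ _ _ _ _ _ _ h_convex nu_gt0
  (pmin (A *m x1)) (pmin (A *m x2)).
rewrite -mulmxBr; set dq := _ - _ - _ => /= firm.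
have dqA : enorm dq <= enorm (A *m (x1 - x2)).
  apply: le_of_sqr_le_mul; first exact: enorm_ge0.
  by rewrite sqr_enorm (le_trans firm) // inner_le_enorm.
apply: le_trans (enorm_trmx_mulmx _ _) _.
(* One factor sqrt [L] comes from A^T, the other from A. *)
rewrite -[X in _ <= X * _]sqr_sqrtr // expr2 -mulrA ler_wpM2l ?sqrtr_ge0 //.
exact: le_trans dqA (enorm_mulmx _ _).
Qed.
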